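(* For every constant $k$, the asymptotic approximation ratio achieved by any deterministic online width-$k$ algorithm for unweighted max-sat with input model 0 is strictly less than $2/3$.
   Context: Unweighted max-sat: the input is a set of clauses (sets of literals), each of weight 1; the goal is an assignment maximizing the number of satisfied clauses. Online: variables arrive one at a time in adversarial order and each must be irrevocably assigned upon arrival. In input model 0, the data item of a variable consists only of a list of names and weights of the clauses in which it appears positively and a list of names and weights of the clauses in which it appears negatively. Width-$k$ model: the algorithm maintains a tree of partial assignments with the empty assignment as root at level 0; when the $i$-th variable is processed, each node at level $i-1$ gets at least one child (no cutting allowed), each child extending its parent by a value for that variable; every level has at most $k$ nodes; at the end the best complete assignment is output. The asymptotic approximation ratio of $\mathbb{A}$ is $\liminf_{n}\inf_{I\in\mathcal{I}_n} v(\mathbb{A},I)/v(I)$, where $\mathcal{I}_n$ are the instances of size $n$. *)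

(* Defs.v *)
From mathcomp Require Import all_boot all_order all_algebra.
From mathcomp Require Import all_classical all_reals all_analysis.
Set Implicit Arguments. Unset Strict Implicit. Unset Printing Implicit Defensive.
Import Order.TTheory GRing.Theory Num.Theory.

(* Clause names are natural numbers.  The data item of a variable (input
   model 0) is the pair (names of clauses where it occurs positively,
   names of clauses where it occurs negatively); all weights are 1 and are
   therefore omitted.  An instance is the sequence of data items of its
   variables in (adversarial) arrival order: variable i is the i-th item. *)
Definition item := (seq nat * seq nat)%type.
Definition instance := seq item.

Definition clause_names (I : instance) : seq nat :=
  undup (flatten [seq d.1 ++ d.2 | d <- I]).

Definition clause_lits (I : instance) (c : nat) : seq (bool * bool) :=
  [seq (c \in d.1, c \in d.2) | d <- I].

(* the input is a (non-empty) SET of clauses: distinct names denote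
   distinct sets of literals *)
Definition valid_instance (I : instance) : bool :=
  (clause_names I != [::]) && uniq [seq clause_lits I c | c <- clause_names I].

(* a (partial/complete) assignment: the i-th bool is the value of variable i *)
Definition sat_clause (I : instance) (a : seq bool) (c : nat) : bool :=
  has (fun p : item * bool =>
         ((c \in p.1.1) && p.2) || ((c \in p.1.2) && ~~ p.2)) (zip I a).

Definition nsat (I : instance) (a : seq bool) : nat :=
  count (sat_clause I a) (clause_names I).

Definition opt (I : instance) : nat :=
  \max_(t : (size I).-tuple bool) nsat I t.

(* [levels h] is the list of nodes (partial assignments) at level (size h)
   of the tree after the data items h have been processed; being a function
   of the prefix of data items only, the algorithm is deterministic and
   online (decisions are irrevocable, since level i+1 must extend level i). *)
Record width_alg (k : nat) := WidthAlg {
  levels : instance -> seq (seq bool);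
  levels_root : levels [::] = [:: [::]];
  levels_width : forall h, size (levels h) <= k;
  levels_extend : forall h d a, a \in levels (rcons h d) ->
      exists2 b, b \in levels h & exists x, a = rcons b x;
  levels_nocut : forall h d b, b \in levels h ->
      exists x, rcons b x \in levels (rcons h d)
}.

Definition alg_value k (A : width_alg k) (I : instance) : nat :=
  \max_(a <- levels A I) nsat I a.

Local Open Scope ring_scope.

Definition ratio (R : realType) k (A : width_alg k) (I : instance) : R :=
  (alg_value A I)%:R / (opt I)%:R.

Definition inf_ratio (R : realType) k (A : width_alg k) (n : nat) : \bar R :=
  ereal_inf [set (ratio R A I)%:E | I in [set I : instance | size I = n /\ valid_instance I]].

Definition asymptotic_ratio (R : realType) k (A : width_alg k) : \bar R :=
  limn_einf (inf_ratio R A).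

(* Main.v *)
(* Nodes are never cut, so along a history maximizing the number of nodes the
   tree stops branching, and from there on the algorithm is a finite family of
   online strategies.  Against these the adversary introduces n fresh clauses,
   plays towards an assignment [a], and keeps pairing two clauses c, c' which
   [a] does not satisfy and which are falsified by the same set U of strategies:
   the next variable occurs positively in c and negatively in c'.  If T is the
   set of strategies of U choosing true, the adversary answers true and false
   alternately for each (U, T), so that half of the time a strategy loses a
   clause that [a] has satisfied, and half of the time one of its falsified
   clauses survives with the smaller set T or U :\: T.  When T is empty or all
   of U, it gives the answer that makes all of U lose.  A clause falsified by m
   strategies thus ends up costing each of them 1/3 + (2/3) 4^-m clauses, while
   [a] satisfies all but boundedly many.  Since every item has at most one
   positive and one negative occurrence, clauses with different names differ. *)
Require Import Defs.
From mathcomp Require Import all_boot all_order all_algebra.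
From mathcomp Require Import all_classical all_reals all_analysis.
From mathcomp Require Import lra.
Set Implicit Arguments. Unset Strict Implicit. Unset Printing Implicit Defensive.
Import Order.TTheory GRing.Theory Num.Theory.
Local Open Scope ring_scope.

(** * Online strategies on items with at most one occurrence per sign *)

Definition small_item (d : item) : bool := (size d.1 <= 1)%N && (size d.2 <= 1)%N.

(** Only continuations by small items are constrained: the adversary plays no others, and the tree
    is known not to branch along these only. *)
Definition online_from (h0 : instance) (t : instance -> seq bool) : Prop :=
  size (t h0) = size h0 /\
  forall e d, all small_item (rcons e d) ->
    exists x, t (h0 ++ rcons e d) = rcons (t (h0 ++ e)) x.

Lemma size_online_from h0 t e :
  online_from h0 t -> all small_item e -> size (t (h0 ++ e)) = size (h0 ++ e).
Proof.
case=> sz ext; elim/last_ind: e => [|e d IH] sm; first by rewrite cats0.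
have [x ->] := ext _ _ sm.
by move: sm; rewrite all_rcons => /andP[_ /IH]; rewrite -rcons_cat !size_rcons => ->.
Qed.

Lemma sat_clause_rcons (h : instance) (a : seq bool) (d : item) (x : bool) c :
  size a = size h ->
  sat_clause (rcons h d) (rcons a x) c =
    [|| sat_clause h a c, (c \in d.1) && x | (c \in d.2) && ~~ x].
Proof.
by move=> sz; rewrite /sat_clause zip_rcons // has_rcons /= orbC orbA.
Qed.

(* The solution of f 0 = 1 and 4 * f m.+1 = 1 + f m. *)
Definition loss_rate (R : realType) (m : nat) : R := 1 / 3 + 2 / 3 * (4 ^+ m)^-1.

(** * Estimates for the loss rate and for one round of the game *)

Section LossRate.
Variable R : realType.

Lemma loss_rate_gt m : 1 / 3 < loss_rate R m.
Proof.
rewrite /loss_rate ltrDl mulr_gt0 ?invr_gt0 ?exprn_gt0 //; lra.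
Qed.

Lemma loss_rateS m : 4 * loss_rate R m.+1 = 1 + loss_rate R m.
Proof.
rewrite /loss_rate exprS invfM; lra.
Qed.

Lemma loss_rate_anti m n : (m <= n)%N -> loss_rate R n <= loss_rate R m.
Proof.
move=> mn; rewrite /loss_rate lerD2l ler_pM2l ?lef_pV2 ?posrE ?exprn_gt0 //.
by rewrite ler_weXn2l //; lra.
Qed.

Lemma loss_rate_le1 m : loss_rate R m <= 1.
Proof.
by apply: le_trans (loss_rate_anti (leq0n m)) _; rewrite /loss_rate expr0; lra.
Qed.

Lemma loss_rate_le_half m : (0 < m)%N -> loss_rate R m <= 1 / 2.
Proof.
by move=> m0; apply: le_trans (loss_rate_anti m0) _; rewrite /loss_rate expr1; lra.
Qed.

Variable I : finType.
Implicit Types (U T : {set I}) (b : bool) (i : I).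

(* Change of the potential of strategy i when two clauses of type U are paired,
   T is the set of strategies choosing true and the adversary answers b. *)
Definition gain U T b i : R :=
  if i \in U then
    (if (i \in T) == b then loss_rate R #|if b then T else U :\: T| else 1)
      - 2 * loss_rate R #|U|
  else 0.

Lemma gain_ge U T b i : -1 <= gain U T b i.
Proof.
rewrite /gain; case: ifP => iU; last lra.
have U0 : (0 < #|U|)%N by apply/card_gt0P; exists i.
have half := loss_rate_le_half U0.
have third := loss_rate_gt #|if b then T else U :\: T|.
by case: (_ == b); lra.
Qed.

(** Every member of [U] loses a full clause, and the two paired clauses were counted at most 1/2
    each. *)
Lemma gain_set0 U i : 0 <= gain U finset.set0 true i.
Proof.
rewrite /gain finset.in_set0; case: ifP => // iU.
have U0 : (0 < #|U|)%N by apply/card_gt0P; exists i.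
have := loss_rate_le_half U0; rewrite /=; lra.
Qed.

Lemma gain_self U i : 0 <= gain U U false i.
Proof.
rewrite /gain; case: ifP => // iU; rewrite iU /=.
have U0 : (0 < #|U|)%N by apply/card_gt0P; exists i.
by have := loss_rate_le_half U0; lra.
Qed.

(** Of the two answers one costs [i] a clause and the other leaves it with a live clause of type [T]
    or [U :\: T]. If [m] is the size of that smaller type, the sum is
    [1 + loss_rate m - 4 * loss_rate #|U|], and the recurrence applies since [m < #|U|]. *)
Lemma gain_balance U T i :
  T \subset U -> T != finset.set0 -> T != U -> 0 <= gain U T true i + gain U T false i.
Proof.
move=> TU T0 TneU; rewrite /gain; case: ifP => iU; last by rewrite addr0.
have ltT : (#|T| < #|U|)%N by rewrite proper_card // finset.properEneq TneU.
have ltD : (#|U :\: T| < #|U|)%N.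
  rewrite proper_card // finset.properEneq finset.subsetDl andbT.
  apply: contraNneq T0 => /finset.setDidPl; rewrite -finset.setI_eq0 => /eqP UT0.
  by rewrite -(finset.setIidPr TU) UT0.
have key m : (m < #|U|)%N -> 4 * loss_rate R #|U| <= 1 + loss_rate R m.
  by move=> mU; rewrite -loss_rateS ler_pM2l ?loss_rate_anti //; lra.
have := key _ ltT; have := key _ ltD.
by case: (i \in T) => /=; lra.
Qed.

End LossRate.

(** * Amortizing the answers of the adversary *)

Lemma sum_pred1_seq (R : nmodType) (T : eqType) (r : seq T) (x : T) (F : T -> R) :
  x \in r -> uniq r -> \sum_(i <- r | i == x) F i = F x.
Proof.
move=> xr ur; rewrite big_mkcond (bigD1_seq x) //= eqxx big1 ?addr0 //.
by move=> i /negbTE ->.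
Qed.

(* [pend] is the set of the (U, T) which have received one more answer true than
   false; their next answer is false. *)
Definition credit (R : realType) (I : finType) (pend : {set {set I} * {set I}}) i : R :=
  \sum_(p in pend) gain R p.1 p.2 true i.

(** One answer serves all strategies at once, and potential minus credit never decreases. A first
    answer for [(U, T)] is booked as credit; the second cancels it by [gain_balance]. *)
Lemma choose_bit (R : realType) (I : finType) (U T : {set I}) pend :
  T \subset U -> exists b pend', forall i : I,
    credit R pend' i <= credit R pend i + gain R U T b i.
Proof.
move=> TU.
have [->|T0] := eqVneq T finset.set0.
  by exists true, pend => i; rewrite lerDl gain_set0.
have [->|TneU] := eqVneq T U; first by exists false, pend => i; rewrite lerDl gain_self.
have [inp|ninp] := boolP ((U, T) \in pend).
  exists false, (pend :\ (U, T)) => i.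
  rewrite [credit R pend i](big_setD1 _ inp) /= -/(credit _ _ _).
  by rewrite addrAC lerDr gain_balance.
exists true, ((U, T) |: pend) => i.
by rewrite /credit big_setU1 //= addrC.
Qed.

Lemma credit_ge (R : realType) (I : finType) (pend : {set {set I} * {set I}}) i :
  - #|{: {set I} * {set I}}|%:R <= credit R pend i.
Proof.
apply: (@le_trans _ _ (- #|pend|%:R)); first by rewrite lerN2 ler_nat max_card.
by rewrite -sumr_const -sumrN; apply: ler_sum => p _; exact: gain_ge.
Qed.

(** * The pairing game against a finite family of strategies *)

Section Game.
Variables (R : realType) (I : finType) (s : I -> instance -> seq bool).
Variable cs : seq nat.
Hypothesis uniq_cs : uniq cs.

Definition falsifiers (h : instance) (c : nat) : {set I} :=
  [set i | ~~ sat_clause h (s i h) c].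

(** A clause missed by [i] counts fully once [a] satisfies it; while [a] leaves it open, it counts
    as the loss it will eventually cause, which depends on its type only. *)
Definition weight (h : instance) (a : seq bool) (i : I) (c : nat) : R :=
  if i \in falsifiers h c then
    (if sat_clause h a c then 1 else loss_rate R #|falsifiers h c|)
  else 0.

Definition potential (h : instance) (a : seq bool) (i : I) : R :=
  \sum_(c <- cs) weight h a i c.

(** After the round [c] has type [U :\: T] and [c'] has type [T], where [T] is the set of strategies
    choosing true; [a] satisfies exactly one of the two, and no other weight moves. *)
Lemma potential_pair h a c c' b (x : I -> bool) i :
  let d : item := ([:: c], [:: c']) in
  let U := falsifiers h c in
  size a = size h -> (forall j, size (s j h) = size h) ->
  (forall j, s j (rcons h d) = rcons (s j h) (x j)) ->
  c \in cs -> c' \in cs -> c != c' -> falsifiers h c' = U ->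
  ~~ sat_clause h a c -> ~~ sat_clause h a c' ->
  potential (rcons h d) (rcons a b) i =
    potential h a i + gain R U [set j in U | x j] b i.
Proof.
move=> d U sza szs sx ccs c'cs cc' Uc' ua ua'.
have satE e : sat_clause (rcons h d) (rcons a b) e =
    [|| sat_clause h a e, (e == c) && b | (e == c') && ~~ b].
  by rewrite sat_clause_rcons // !inE.
have falsE e : falsifiers (rcons h d) e =
    [set j in falsifiers h e | ~~ ((e == c) && x j || (e == c') && ~~ x j)].
  by apply/finset.setP => j; rewrite !inE sx sat_clause_rcons // !inE negb_or.
have c'c : (c' == c) = false by rewrite eq_sym (negbTE cc').
have Fc : falsifiers (rcons h d) c = U :\: [set j in U | x j].
  apply/finset.setP => j; rewrite falsE !finset.inE eqxx (negbTE cc') orbF.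
  by case: (sat_clause _ _ _); case: (x j).
have Fc' : falsifiers (rcons h d) c' = [set j in U | x j].
  by apply/finset.setP => j; rewrite falsE Uc' !inE eqxx c'c /= negbK.
(* Writing the new weight as the old one plus corrections at [c] and [c'] lets the sum split. *)
have weightE e : weight (rcons h d) (rcons a b) i e = weight h a i e +
    ((if e == c then weight (rcons h d) (rcons a b) i c - weight h a i c else 0) +
     (if e == c' then weight (rcons h d) (rcons a b) i c' - weight h a i c' else 0)).
  have [->|ec] := eqVneq e c; first by rewrite (negbTE cc'); lra.
  have [->|ec'] := eqVneq e c'; first by lra.
  rewrite /weight satE (negbTE ec) (negbTE ec') !orbF /= !addr0.
  suff -> : falsifiers (rcons h d) e = falsifiers h e by [].
  by apply/finset.setP => j; rewrite falsE !inE (negbTE ec) (negbTE ec') andbT.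
rewrite /potential (eq_bigr _ (fun e _ => weightE e)) !big_split /=.
rewrite -!big_mkcond /= !sum_pred1_seq //; congr (_ + _).
rewrite /weight Fc Fc' !satE Uc' -/U (negbTE ua) (negbTE ua') !eqxx (negbTE cc') c'c /gain !finset.inE.
by case: (sat_clause h (s i h) c); case: (x i); case: (b) => /=; lra.
Qed.

(** Induction on the number of live clauses, as each round satisfies one. The constant subtracted
    from the potential pays for the answers still unmatched at the end. *)
Lemma play (h0 : instance) (e : instance) (a : seq bool) pend :
  let names_in d := all (mem cs) (d.1 ++ d.2) in
  let live e a := [seq c <- cs | ~~ sat_clause (h0 ++ e) a c] in
  (forall i, online_from h0 (s i)) ->
  all small_item e -> all names_in e -> size a = size (h0 ++ e) ->
  exists e' a', [/\ all small_item e', all names_in e', size a' = size (h0 ++ e'),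
    (size (live e' a') <= #|{set I}|)%N &
    forall i, potential (h0 ++ e) a i - credit R pend i - #|{: {set I} * {set I}}|%:R
      <= potential (h0 ++ e') a' i].
Proof.
move=> names_in live onl.
have [n] := ubnP (size (live e a)); elim: n e a pend => // n IH e a pend.
rewrite ltnS => len sme nme sza.
have [small|big] := leqP (size (live e a)) #|{set I}|.
  exists e, a; split => // i.
  by have := credit_ge R pend i; lra.
(* Pigeonhole: more live clauses than sets of strategies, so two of them have the same type. *)
have /(uniqPn finset.set0) [p [q [pq]]] : ~~ uniq (map (falsifiers (h0 ++ e)) (live e a)).
  apply/negP => /card_uniqP; rewrite size_map => eqs.
  by have := max_card (mem (map (falsifiers (h0 ++ e)) (live e a))); rewrite eqs leqNgt big.
rewrite size_map => qlt.
rewrite !(nth_map 0%N) // ?(ltn_trans pq) //.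
set c := nth _ _ p; set c' := nth _ _ q => eqU.
have : c \in live e a by rewrite mem_nth // (ltn_trans pq).
have : c' \in live e a by rewrite mem_nth.
rewrite !mem_filter => /andP[ua' c'cs] /andP[ua ccs].
have cc' : c != c'.
  by rewrite nth_uniq ?filter_uniq // ?(ltn_trans pq) // neq_ltn pq.
set d : item := ([:: c], [:: c']).
have sm' : all small_item (rcons e d) by rewrite all_rcons sme.
have nm' : all names_in (rcons e d) by rewrite all_rcons nme /names_in /= ccs c'cs.
pose x i := last false (s i (h0 ++ rcons e d)).
have sx i : s i (rcons (h0 ++ e) d) = rcons (s i (h0 ++ e)) (x i).
  by rewrite /x rcons_cat; have [y ->] := (onl i).2 _ _ sm'; rewrite last_rcons.
have szs j : size (s j (h0 ++ e)) = size (h0 ++ e) by apply: size_online_from.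
set U := falsifiers (h0 ++ e) c.
have [b [pend' cr]] := choose_bit R pend (finset.subsetIl U [set j | x j]).
have := IH (rcons e d) (rcons a b) pend' _ sm' nm'.
case.
- apply: leq_trans len.
  (* [z] is the clause that the answer satisfies, so it leaves the live list. *)
  pose z := if b then c else c'.
  have satE w : sat_clause (h0 ++ rcons e d) (rcons a b) w =
      [|| sat_clause (h0 ++ e) a w, (w == c) && b | (w == c') && ~~ b].
    by rewrite -rcons_cat sat_clause_rcons // !inE.
  apply: (@uniq_leq_size _ (z :: live (rcons e d) (rcons a b))).
    rewrite /= filter_uniq // andbT mem_filter satE /z.
    by case: (b); rewrite eqxx /= ?orbT.
  move=> w; rewrite inE => /predU1P[->|]; first by rewrite mem_filter /z; case: (b); rewrite ?ua ?ua'.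
  by rewrite !mem_filter satE negb_or => /andP[/andP[-> _] ->].
- by rewrite -rcons_cat !size_rcons sza.
move=> e' [a' [? ? ? ? pot]]; exists e', a'; split => // i.
apply: le_trans (pot i); rewrite -rcons_cat (potential_pair b i sza szs sx ccs c'cs cc' (esym eqU) ua ua').
have -> : [set j in U | x j] = U :&: [set j | x j].
  by apply/finset.setP => j; rewrite !finset.inE.
by have := cr i; lra.
Qed.

End Game.

(** * Clause names, validity and the optimum *)

Lemma clause_namesP (h : instance) c :
  reflect (exists2 d, d \in h & c \in d.1 ++ d.2) (c \in clause_names h).
Proof.
rewrite /clause_names mem_undup; apply: (iffP flattenP).
  by move=> [_ /mapP[d dh ->] cd]; exists d.
by move=> [d dh cd]; exists (d.1 ++ d.2) => //; apply/mapP; exists d.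
Qed.

Lemma clause_names_cat h e c :
  (c \in clause_names (h ++ e)) = (c \in clause_names h) || (c \in clause_names e).
Proof. by rewrite /clause_names map_cat flatten_cat !mem_undup mem_cat. Qed.

Lemma sat_clause_named h a c : sat_clause h a c -> c \in clause_names h.
Proof.
move=> /hasP[[d x] dx cd]; apply/clause_namesP; exists d.
  elim: h a dx => [|d' h IH] [|x' a] //=; rewrite !inE => /predU1P[[-> _]|/IH ->].
    by rewrite eqxx.
  by rewrite orbT.
by rewrite mem_cat; case/orP: cd => /andP[-> _]; rewrite ?orbT.
Qed.

(** If [c] occurs in [d], a clause with the same literals occurs in the same list of [d], which has
    at most one entry. *)
Lemma valid_small h : all small_item h -> clause_names h != [::] -> valid_instance h.
Proof.
move=> sm names; rewrite /valid_instance names /= map_inj_in_uniq ?undup_uniq //.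
have single (w : seq nat) x y : (size w <= 1)%N -> x \in w -> y \in w -> x = y.
  by case: w => [|z [|? ?]] //= _; rewrite !inE => /eqP -> /eqP ->.
move=> c c' /clause_namesP[d dh cd] _ /eq_in_map /(_ d dh) [e1 e2].
have /andP[s1 s2] := allP sm _ dh.
by move: cd; rewrite mem_cat => /orP[] cd; [apply: (single _ _ _ s1)|apply: (single _ _ _ s2)];
  rewrite // -?e1 -?e2.
Qed.

Lemma leq_opt h a : size a = size h -> (nsat h a <= opt h)%N.
Proof.
move=> /eqP sz; rewrite /opt; exact: (@leq_bigmax _ (fun t : (size h).-tuple bool => nsat h t) (Tuple sz)).
Qed.

(** * From one bad instance to the asymptotic ratio *)

Section Padding.
(* Appending variables without occurrences changes neither value, so a single
   bad instance bounds the ratio at all larger sizes. *)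
Definition idle : item := ([::], [::]).

Lemma clause_names_idle h : clause_names (rcons h idle) = clause_names h.
Proof. by rewrite /clause_names map_rcons -cats1 flatten_cat /= cats0. Qed.

Lemma nsat_idle h a x : size a = size h -> nsat (rcons h idle) (rcons a x) = nsat h a.
Proof.
move=> sz; rewrite /nsat clause_names_idle; apply: eq_count => c.
by rewrite sat_clause_rcons //= orbF.
Qed.

Lemma opt_idle h : (opt h <= opt (rcons h idle))%N.
Proof.
apply/bigmax_leqP => t _.
by rewrite -(nsat_idle false) ?size_tuple // leq_opt // !size_rcons size_tuple.
Qed.

Variables (k : nat) (A : width_alg k).

Lemma size_levels h a : a \in levels A h -> size a = size h.
Proof.
elim/last_ind: h a => [|h d IH] a; first by rewrite levels_root inE => /eqP ->.
by move=> /levels_extend[b /IH sb [x ->]]; rewrite !size_rcons sb.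
Qed.

Lemma alg_value_idle h : (alg_value A (rcons h idle) <= alg_value A h)%N.
Proof.
apply/bigmax_leqP_seq => a /levels_extend[b bh [x ->]] _.
rewrite nsat_idle ?(size_levels bh) // /alg_value.
exact: (@leq_bigmax_seq _ (levels A h) xpredT (nsat h) b bh isT).
Qed.

Lemma ratio_pad (R : realType) h j : (0 < opt h)%N ->
  Defs.ratio R A (h ++ nseq j idle) <= Defs.ratio R A h.
Proof.
move=> opt0; elim: j h opt0 => [|j IH] h opt0; first by rewrite cats0.
have opt1 := leq_trans opt0 (opt_idle h).
rewrite /= -cat_rcons; apply: le_trans (IH _ opt1) _.
by rewrite /Defs.ratio ler_pM ?invr_ge0 ?ler0n ?ler_nat ?alg_value_idle //
  lef_pV2 ?posrE ?ltr0n // ler_nat opt_idle.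
Qed.

Lemma asymptotic_ratio_le (R : realType) h :
  all small_item h -> (0 < opt h)%N ->
  (asymptotic_ratio R A <= (Defs.ratio R A h)%:E)%E.
Proof.
move=> sm opt0.
have names : clause_names h != [::].
  apply: contraTneq opt0 => nm; rewrite -eqn0Ngt -leqn0.
  by apply/bigmax_leqP => t _; rewrite /nsat nm.
have namesP j : clause_names (h ++ nseq j idle) = clause_names h.
  elim: (j) (h) => [|j' IH] h'; first by rewrite cats0.
  by rewrite /= -cat_rcons IH clause_names_idle.
rewrite /asymptotic_ratio limn_einf_lim; apply: lime_le; first exact: is_cvg_einfs.
(* From [size h] on, the tail infimum is at most its first term, which is at most the ratio of [h]
   padded to size [n]. *)
exists (size h) => // n /= hn; apply: ge_ereal_inf.
exists (inf_ratio R A n); first by exists n => /=.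
apply: ge_ereal_inf; exists (Defs.ratio R A (h ++ nseq (n - size h) idle))%:E.
  exists (h ++ nseq (n - size h) idle) => //; split.
    by rewrite size_cat size_nseq subnKC.
  apply: valid_small; last by rewrite namesP.
  by rewrite all_cat sm all_nseq orbT.
by rewrite lee_fin ratio_pad.
Qed.
End Padding.

(** * A width-bounded tree eventually stops branching *)

Section NoBranching.
Variables (k : nat) (A : width_alg k).

Lemma take_levels h e b : b \in levels A (h ++ e) -> take (size h) b \in levels A h.
Proof.
elim/last_ind: e b => [|e d IH] b.
  by rewrite cats0 => bh; rewrite -(size_levels bh) take_size.
rewrite -rcons_cat => /levels_extend[b' b'h [x ->]].
by rewrite -cats1 takel_cat ?IH // (size_levels b'h) size_cat leq_addr.
Qed.

Lemma lift_levels h e a : a \in levels A h ->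
  exists2 b, b \in levels A (h ++ e) & take (size h) b = a.
Proof.
move=> ah; elim/last_ind: e => [|e d [b bh tb]].
  by exists a; rewrite ?cats0 // -(size_levels ah) take_size.
have [x bx] := levels_nocut d bh; exists (rcons b x); first by rewrite -rcons_cat.
by rewrite -cats1 takel_cat // (size_levels bh) size_cat leq_addr.
Qed.

(** Repetitions are removed because a level may list the same node several times. *)
Definition nnodes h := size (undup (levels A h)).

Lemma max_nodes : exists2 h, all small_item h &
  forall h', all small_item h' -> (nnodes h' <= nnodes h)%N.
Proof.
pose P n := `[< exists2 h, all small_item h & nnodes h = n >].
have exP : exists n, P n by exists (nnodes [::]); apply/asboolP; exists [::].
have ubP n : P n -> (n <= k)%N.
  move=> /asboolP[h _ <-]; exact: leq_trans (size_undup _) (levels_width _ _).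
case: (ex_maxnP exP ubP) => n /asboolP[h sm <-] mx; exists h => // h' sm'.
by apply: mx; apply/asboolP; exists h'.
Qed.

Variable h0 : instance.
Hypothesis max_h0 : forall e, all small_item e -> (nnodes (h0 ++ e) <= nnodes h0)%N.

(** Without cutting, truncation maps onto the level of [h0]; by maximality there are no more
    distinct nodes than there, so it is injective. *)
Lemma take_levels_inj e : all small_item e ->
  {in levels A (h0 ++ e) &, injective (take (size h0))}.
Proof.
move=> sm.
have um : uniq (map (take (size h0)) (undup (levels A (h0 ++ e)))).
  apply: (leq_size_uniq (undup_uniq (levels A h0))); last by rewrite size_map max_h0.
  move=> a; rewrite mem_undup => /(lift_levels e)[b bh <-].
  by rewrite map_f // mem_undup.
move=> b b' bh b'h eqt.
have ib : (index b (undup (levels A (h0 ++ e))) < nnodes (h0 ++ e))%N.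
  by rewrite index_mem mem_undup.
have ib' : (index b' (undup (levels A (h0 ++ e))) < nnodes (h0 ++ e))%N.
  by rewrite index_mem mem_undup.
move: um => /(uniqP [::]) /(_ (index b (undup (levels A (h0 ++ e))))
  (index b' (undup (levels A (h0 ++ e))))).
rewrite !inE size_map !(nth_map [::]) // !nth_index ?mem_undup // => /(_ ib ib' eqt).
by move=> /(index_inj [::]); apply; rewrite mem_undup.
Qed.

(** The descendant at [h] of the [i]-th node of [h0]. On small continuations of [h0] the filtered
    list has one distinct entry, and the default of [head] is never reached. *)
Definition node (i : 'I_(nnodes h0)) (h : instance) : seq bool :=
  head [::] [seq b <- levels A h | take (size h0) b == nth [::] (undup (levels A h0)) i].

Lemma nodeP i e : node i (h0 ++ e) \in levels A (h0 ++ e) /\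
  take (size h0) (node i (h0 ++ e)) = nth [::] (undup (levels A h0)) i.
Proof.
set a := nth _ _ i.
have : a \in levels A h0 by rewrite -mem_undup mem_nth.
move=> /(lift_levels e)[b bh tb].
have : b \in [seq b <- levels A (h0 ++ e) | take (size h0) b == a].
  by rewrite mem_filter tb eqxx.
rewrite /node -/a; case E: [seq b <- _ | _] => [|b' s] // _.
have : b' \in [seq b <- levels A (h0 ++ e) | take (size h0) b == a].
  by rewrite E mem_head.
by rewrite mem_filter => /andP[/eqP].
Qed.

Lemma node_unique (i : 'I_(nnodes h0)) e b : all small_item e -> b \in levels A (h0 ++ e) ->
  take (size h0) b = nth [::] (undup (levels A h0)) i -> b = node i (h0 ++ e).
Proof.
move=> sm bh tb; have [nh tn] := nodeP i e.
by apply: (take_levels_inj sm) => //; rewrite tb tn.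
Qed.

(** The parent of the current node descends from the same node of [h0], so by uniqueness it is the
    previous value of the strategy. *)
Lemma node_online i : online_from h0 (node i).
Proof.
split=> [|e d sm].
  by have [nh _] := nodeP i [::]; rewrite cats0 in nh; exact: size_levels nh.
have [+ tn] := nodeP i (rcons e d).
rewrite -rcons_cat => /levels_extend[b bh [x nx]]; exists x.
rewrite nx; congr rcons.
apply: node_unique => //; first by move: sm; rewrite all_rcons => /andP[].
by rewrite -tn -rcons_cat nx -cats1 takel_cat // (size_levels bh) size_cat leq_addr.
Qed.

Lemma node_cover e b : all small_item e -> b \in levels A (h0 ++ e) ->
  exists i, b = node i (h0 ++ e).
Proof.
move=> sm bh; have := take_levels bh; rewrite -mem_undup => th.
have lt : (index (take (size h0) b) (undup (levels A h0)) < nnodes h0)%N.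
  by rewrite index_mem.
by exists (Ordinal lt); apply: node_unique => //=; rewrite nth_index.
Qed.

End NoBranching.

(** * Choice of the number of fresh clauses and the final count *)

Lemma bad_instance (R : realType) (k : nat) (A : width_alg k) :
  exists h, [/\ all small_item h, (0 < opt h)%N & Defs.ratio R A h < 2 / 3].
Proof.
have [h0 sm0 max0] := max_nodes A.
have max_h0 e : all small_item e -> (nnodes A (h0 ++ e) <= nnodes A h0)%N.
  by move=> sm; rewrite max0 // all_cat sm0.
pose I := 'I_(nnodes A h0).
pose s : I -> instance -> seq bool := @node k A h0.
pose f := loss_rate R #|I|.
pose L := size (clause_names h0).
pose M := #|{set I}|.
pose C := #|{: {set I} * {set I}}|.
have f_gt : 0 < f - 1 / 3 by have := loss_rate_gt R #|I|; rewrite /f; lra.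
have f_le1 : f <= 1 := loss_rate_le1 R #|I|.
(* The algorithm gets at most [L + n * (1 - f) + C] and the optimum is at least [n - M]. The factor
   2/3 separates them as soon as [n * (f - 1 / 3)] exceeds [L + M + C]. *)
pose B : R := (L + M + C)%:R / (f - 1 / 3).
pose n := Num.bound B.
have Bn : (L%:R + M%:R + C%:R) < n%:R * (f - 1 / 3).
  have : B < n%:R by apply: archi_boundP; rewrite divr_ge0 // ltW.
  by rewrite ltr_pdivrMr // !natrD.
(* The names start above all those of [h0], hence are fresh. *)
pose cs := iota (\max_(c <- clause_names h0) c).+1 n.
have ucs : uniq cs by exact: iota_uniq.
have fresh c : c \in cs -> c \notin clause_names h0.
  rewrite mem_iota => /andP[lt _]; apply: contraTN lt => ch.
  by rewrite -leqNgt (@leq_bigmax_seq _ (clause_names h0) xpredT id c).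
pose a0 := nseq (size h0) false.
have [||||e [a [sme nme sza small pot]]] :=
  @play R I s cs ucs h0 [::] a0 finset.set0 _ _ _ _; rewrite ?cats0 ?size_nseq //.
  by move=> i; apply: node_online.
set h := h0 ++ e in sza small pot.
have names_h c : c \in clause_names h -> c \in clause_names h0 ++ cs.
  rewrite clause_names_cat mem_cat => /orP[->//|/clause_namesP[d de cd]].
  by apply/orP; right; exact: allP (allP nme _ de) _ cd.
have sat_ge : (n - M <= nsat h a)%N.
  rewrite -(size_iota (\max_(c <- clause_names h0) c).+1 n) -/cs leq_subLR.
  rewrite -(count_predC (fun c => ~~ sat_clause h a c) cs) -size_filter leq_add //.
  rewrite /nsat -!size_filter; apply: uniq_leq_size; first exact: filter_uniq.
  move=> c; rewrite !mem_filter /= negbK => /andP[sc _].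
  by rewrite sc (sat_clause_named sc).
have opt_ge : (n - M <= opt h)%N := leq_trans sat_ge (leq_opt sza).
have n_gt : M%:R < n%:R :> R.
  have := ler0n R L; have := ler0n R C; have := ler0n R n; have := ler0n R M.
  nra.
have opt_pos : (0 < opt h)%N.
  by apply: leq_trans opt_ge; rewrite subn_gt0; rewrite ltr_nat in n_gt.
exists h; split => //; first by rewrite all_cat sm0.
have opt_geR : n%:R - M%:R <= (opt h)%:R :> R.
  by rewrite -natrB ?ler_nat // ltnW //; rewrite ltr_nat in n_gt.
have sat_le i : (nsat h (s i h))%:R <= L%:R + (n%:R - (n%:R * f - C%:R)) :> R.
  (* No fresh clause is satisfied yet, so each has the full set of strategies as its type and weighs
     [f]. *)
  have pot0 : potential R s cs h0 a0 i = n%:R * f.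
    rewrite /potential (eq_big_seq (fun=> f)); last first.
      move=> c /fresh nc; rewrite /weight.
      have unsat b : sat_clause h0 b c = false.
        by apply/negP => /sat_clause_named; apply/negP.
      have -> : falsifiers s h0 c = finset.setT.
        by apply/finset.setP => j; rewrite !finset.inE unsat.
      by rewrite finset.in_setT unsat cardsT.
    by rewrite big_const_seq count_predT size_iota iter_addr_0 mulr_natl.
  (* Weights are at most 1, so the final potential bounds from below the number of fresh clauses the
     strategy misses. *)
  have : potential R s cs h a i <= (count (fun c => ~~ sat_clause h (s i h) c) cs)%:R.
    rewrite /potential -sum1_count natr_sum [leRHS]big_mkcond /=; apply: ler_sum => c _.
    rewrite /weight finset.inE; case: ifP => // _.
    by case: ifP => // _; exact: loss_rate_le1.
  have : (nsat h (s i h) <= L + count (sat_clause h (s i h)) cs)%N.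
    rewrite /nsat /L -!size_filter.
    have sub : (size (seq.filter (sat_clause h (s i h)) (clause_names h)) <=
                size (seq.filter (sat_clause h (s i h)) (clause_names h0 ++ cs)))%N.
      apply: uniq_leq_size; first by rewrite filter_uniq // undup_uniq.
      by move=> c; rewrite !mem_filter => /andP[-> /names_h].
    apply: leq_trans sub _.
    by rewrite filter_cat size_cat leq_add2r size_filter count_size.
  have : (count (sat_clause h (s i h)) cs + count (fun c => ~~ sat_clause h (s i h) c) cs = n)%N.
    by rewrite count_predC size_iota.
  move=> /(congr1 (fun m => m%:R : R)); rewrite natrD -(ler_nat R) natrD.
  have := pot i; rewrite cats0 pot0 /credit finset.big_set0 -/C.
  lra.
have alg_le : (alg_value A h)%:R <= L%:R + (n%:R - (n%:R * f - C%:R)) :> R.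
  rewrite /alg_value big_seq; elim/big_ind: _.
  (* The value 0 of an empty maximum is within the bound because [f <= 1]. *)
  - have := ler0n R L; have := ler0n R C; have := ler0n R n; nra.
  - by move=> x y xB yB; rewrite /maxn; case: ifP.
  - by move=> b /(node_cover max_h0 sme)[i ->]; exact: sat_le.
rewrite /Defs.ratio ltr_pdivrMr ?ltr0n //.
have := ler0n R M; lra.
Qed.

Theorem theorem3 (R : realType) (k : nat) (A : width_alg k) :
  (asymptotic_ratio R A < (2 / 3 : R)%:E)%E.
Proof.
have [h [sm opt0 lt]] := bad_instance R A.
by apply: le_lt_trans (asymptotic_ratio_le A R sm opt0) _; rewrite lte_fin.
Qed.
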